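(* There is an absolute constant $C>0$ such that for every $\epsilon>0$ and every natural number $k$ the following holds: every tournament $T$ on $n \geq \epsilon^{-Ck}$ vertices which is $\epsilon$-far from being transitive contains $D_k$ as a subtournament. In other words, $n_0(k,\epsilon)\le \epsilon^{-Ck}$, where $n_0(k,\epsilon)$ is the least integer such that every tournament on at least $n_0(k,\epsilon)$ vertices that is $\epsilon$-far from being transitive contains $D_k$.
   Context: A tournament is an orientation of a complete graph; it is transitive if its vertices can be ordered so that every edge points from an earlier to a later vertex. An $n$-vertex tournament $T$ is $\epsilon$-far from being transitive if for every ordering of $V(T)$, the directions of at least $\epsilon n^2$ edges of $T$ must be switched to obtain a transitive tournament compatible with that ordering (i.e. every ordering has at least $\epsilon n^2$ backwards edges). For a natural number $k$, $D_k$ denotes the tournament on $3k$ vertices consisting of three disjoint vertex classes $V_1,V_2,V_3$ of size $k$, each inducing a transitive subtournament, with all edges directed from $V_1$ to $V_2$, from $V_2$ to $V_3$, and from $V_3$ to $V_1$. *)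

(* Defs.v *)
From mathcomp Require Import all_boot all_fingroup.
From Stdlib Require Import Reals.
Set Implicit Arguments. Unset Strict Implicit. Unset Printing Implicit Defensive.

Definition tournament (n : nat) (T : rel 'I_n) : Prop :=
  (forall u, ~~ T u u) /\ (forall u v, u != v -> T u v = ~~ T v u).

Definition backwards (n : nat) (T : rel 'I_n) (s : {perm 'I_n}) : nat :=
  #|[set p : 'I_n * 'I_n | T p.1 p.2 && (s p.2 < s p.1)%N]|.

Definition eps_far (n : nat) (T : rel 'I_n) (eps : R) : Prop :=
  forall s : {perm 'I_n}, (eps * INR (n * n) <= INR (backwards T s))%R.

(* D_k on 'I_(3k): vertex i lies in class i %/ k (classes 0,1,2); within a
   class edges go from smaller to larger index; between classes c -> c+1 mod 3. *)

Definition Dk (k : nat) : rel 'I_(3 * k) :=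
  fun i j => if (i %/ k == j %/ k)%N then (i < j)%N
             else (j %/ k == (i %/ k).+1 %% 3)%N.

Definition contains_Dk (k n : nat) (T : rel 'I_n) : Prop :=
  exists f : 'I_(3 * k) -> 'I_n, injective f /\
    forall i j, T (f i) (f j) = @Dk k i j.

(* Main.v *)
(** Call an edge u -> v of a window S of L consecutive vertices heavy if it lies in
    at least cL directed triangles inside S, for an absolute constant c.

    Many heavy edges give D_k.  If a proportion 1/d of the pairs of S are heavy edges
    and L >= d^(C k), dependent random choice with 2K random vertices, K = O(k), gives
    a complete K x K bipartite graph of heavy edges A -> B whose sides are transitive.
    The average vertex w closes a triangle with a constant proportion of the pairs of
    A x B; as there are only 2^(2K) adjacency patterns of w to A and B, at least 2^k
    vertices w share k vertices of A and k vertices of B, and k of them form a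
    transitive set.

    Being far from transitive gives many heavy edges.  Order the vertices so as to
    minimise the number of backwards edges.  At some scale L >= n/(16d), a window of
    length 3L contains L^2/(16d) backwards edges y -> i of length about L.  If y -> i is
    not heavy, then i has linearly many in-neighbours, or y linearly many
    out-neighbours, between i and y.  In the former case, minimality forbids to gain by
    moving these in-neighbours Q before i and its out-neighbours P: so at least half of
    the pairs p < q in P x Q are edges p -> q, each of which closes a triangle
    i -> p -> q -> i.  Hence linearly many edges q -> i at i are heavy. *)

Require Import Defs.
From mathcomp Require Import all_boot all_fingroup.
From Stdlib Require Import Reals Classical Lra.
(* Reals rebinds [^] on [nat] to [Nat.pow]; importing ssrnat again restores [expn]. *)
From mathcomp Require Import ssrnat zify.
Set Implicit Arguments. Unset Strict Implicit. Unset Printing Implicit Defensive.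

(** * Double counting and averaging *)

Lemma card_pairs (I J : finType) (P : I -> J -> bool) :
  #|[set p : I * J | P p.1 p.2]| = \sum_i #|[set j | P i j]|.
Proof.
rewrite -sum1_card.
under eq_bigl => p do rewrite inE.
rewrite -(pair_big_dep xpredT P (fun _ _ => 1)) /=.
by apply: eq_bigr => i _; rewrite -sum1_card; apply: eq_bigl => j; rewrite inE.
Qed.

Lemma card_pairsC (I J : finType) (P : I -> J -> bool) :
  #|[set p : I * J | P p.1 p.2]| = #|[set p : J * I | P p.2 p.1]|.
Proof.
rewrite card_pairs (card_pairs (fun j i => P i j)).
under eq_bigr do rewrite -sum1dep_card.
under [RHS]eq_bigr do rewrite -sum1dep_card.
exact: (exchange_big_dep xpredT).
Qed.

Lemma sum_le_heavy (I : finType) (A : {set I}) (F : I -> nat) b c :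
  (forall x, x \in A -> F x <= b) ->
  \sum_(x in A) F x <= #|[set x in A | c <= F x]| * b + #|A| * c.
Proof.
move=> Fb; rewrite (bigID (fun x => c <= F x)) /=; apply: leq_add.
  rewrite -sum_nat_const.
  under [leqRHS]eq_bigl => x do rewrite inE.
  by apply: leq_sum => x /andP[/Fb].
rewrite -sum_nat_const [leqRHS](bigID (fun x => c <= F x)) /=.
apply: leq_trans (leq_addl _ _).
by apply: leq_sum => x /andP[_]; rewrite -ltnNge => /ltnW.
Qed.

Lemma pigeonhole (I J : finType) (A : {set I}) (f : I -> J) m :
  #|J| * m < #|A| -> exists y, m < #|[set x in A | f x == y]|.
Proof.
move=> hA; apply/existsP; apply: contraLR hA; rewrite negb_exists => /forallP h.
rewrite -leqNgt -sum1_card (partition_big f xpredT) //= -sum_nat_const.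
apply: leq_sum => y _; have := h y; rewrite -leqNgt; apply: leq_trans.
by rewrite -sum1_card; apply: eq_leq; apply: eq_bigl => x; rewrite !inE.
Qed.

(** * Transitive subtournaments and recognition of [Dk] *)

(** Any vertex [v] of [U] has [2 ^ k] out-neighbours or [2 ^ k] in-neighbours in [U] when
    [#|U| >= 2 ^ k.+1]; induct there and put [v] first or last. *)
Lemma transitive_seq n (T : rel 'I_n) k (U : {set 'I_n}) :
  tournament T -> 2 ^ k <= #|U| ->
  exists s : seq 'I_n, [/\ size s = k, {subset s <= U} & pairwise T s].
Proof.
case=> Tirr Tasym; elim: k U => [|k IH] U hU; first by exists [::].
have /card_gt0P[v vU] : 0 < #|U| by apply: leq_trans hU; rewrite expn_gt0.
have [ho|hi] := leqP (2 ^ k) #|[set x in U | T v x]|.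
  have [s [ss sU sT]] := IH _ ho; exists (v :: s); split => /=.
  - by rewrite ss.
  - by move=> x; rewrite inE => /predU1P[->//|/sU]; rewrite inE => /andP[].
  - by rewrite sT andbT; apply/allP => x /sU; rewrite inE => /andP[].
have hin : 2 ^ k <= #|[set x in U | T x v]|.
  have: #|U| <= 1 + #|[set x in U | T v x]| + #|[set x in U | T x v]|.
    rewrite -(cards1 v).
    apply: leq_trans (leq_trans (leq_card_setU _ _) (leq_add (leq_card_setU _ _) (leqnn _))).
    apply/subset_leq_card/subsetP => x xU; rewrite !inE xU /=.
    by case: (eqVneq x v) => //= xv; rewrite [T x v]Tasym // orbN.
  move: hU hi; rewrite expnS; lia.
have [s [ss sU sT]] := IH _ hin; exists (rcons s v); split => /=.
- by rewrite size_rcons ss.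
- by move=> x; rewrite mem_rcons inE => /predU1P[->//|/sU]; rewrite inE => /andP[].
- by rewrite pairwise_rcons sT andbT; apply/allP => x /sU; rewrite inE => /andP[].
Qed.

Lemma contains_Dk_blocks n (T : rel 'I_n) k (A B C : seq 'I_n) :
  tournament T -> size A = k -> size B = k -> size C = k ->
  pairwise T A -> pairwise T B -> pairwise T C ->
  allrel T A B -> allrel T B C -> allrel T C A -> contains_Dk k T.
Proof.
move=> [Tirr Tasym] sA sB sC pA pB pC AB BC CA.
case: k sA sB sC => [|k] sA sB sC.
  by exists (fun i : 'I_(3 * 0) => match i with Ordinal m h => False_rect _ (notF h) end);
     split=> [[m h]|[m h]].
have x0 : 'I_n by case: A sA {pA AB CA}.
pose S c := nth [::] [:: A; B; C] c.
pose f (i : 'I_(3 * k.+1)) := nth x0 (S (i %/ k.+1)) (i %% k.+1).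
have Scase (i : 'I_(3 * k.+1)) : i %/ k.+1 < 3 by rewrite ltn_divLR.
have szS c : c < 3 -> size (S c) = k.+1 by case: c => [|[|[|]]].
have pS c : c < 3 -> pairwise T (S c) by case: c => [|[|[|]]].
have nS c : c < 3 -> allrel T (S c) (S (c.+1 %% 3)) by case: c => [|[|[|]]].
have Tn a b : T a b -> T b a = false.
  move=> ab; have anb : a != b by apply: contraTneq ab => ->; apply: Tirr.
  by move: ab; rewrite Tasym // => /negbTE.
have inS (i : 'I_(3 * k.+1)) : i %% k.+1 < size (S (i %/ k.+1)).
  by rewrite szS // ltn_mod.
have same (i j : 'I_(3 * k.+1)) : i %/ k.+1 = j %/ k.+1 -> i < j -> T (f i) (f j).
  move=> ij lt; rewrite /f -ij; apply: (pairwiseP x0 _) => //.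
  - exact: pS.
  - by rewrite inE.
  - by rewrite inE ij.
  - by move: lt; rewrite {1}(divn_eq i k.+1) {1}(divn_eq j k.+1) ij ltn_add2l.
have next (i j : 'I_(3 * k.+1)) : j %/ k.+1 = (i %/ k.+1).+1 %% 3 -> T (f i) (f j).
  move=> ij; have /allrelP := nS _ (Scase i); rewrite /f ij.
  by apply; apply: mem_nth; rewrite // -ij.
have main i j : T (f i) (f j) = @Dk k.+1 i j.
  rewrite /Dk; case: eqP => ij.
    have [lt|lt|/val_inj ->] := ltngtP i j; first exact: same.
    - by apply: Tn; apply: same.
    - exact/negbTE.
  case: eqP => ij'; first exact: next.
  apply: Tn; apply: next; move: (Scase i) (Scase j) ij ij'.
  by case: (_ %/ _) => [|[|[|?]]] //; case: (_ %/ _) => [|[|[|?]]].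
(* Injectivity comes from the adjacencies: if [f i = f j], neither [Dk i j] nor [Dk j i] holds,
   whereas distinct vertices of [Dk] are joined. *)
exists f; split => // i j fij; apply/val_inj; apply/eqP.
have h1 := main i j; have h2 := main j i.
move: h1 h2; rewrite fij (negbTE (Tirr _)) /Dk.
case: (eqVneq (i %/ k.+1)) => [e|ne].
  by move=> h1 h2; rewrite eqn_leq leqNgt -h2 leqNgt -h1.
move=> h1 h2; exfalso; move: (Scase i) (Scase j) ne h1 h2.
by case: (_ %/ _) => [|[|[|?]]] //; case: (_ %/ _) => [|[|[|?]]].
Qed.

(** * Dependent random choice *)

Lemma leq_exp2rW m n e : m <= n -> m ^ e <= n ^ e.
Proof. by case: e => // e; rewrite leq_exp2r. Qed.

Lemma card_ffun_forall (V : finType) t (P : pred V) :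
  #|[set z : {ffun 'I_t -> V} | [forall i, P (z i)]]| = #|P| ^ t.
Proof.
rewrite -[in RHS](card_ord t) -card_ffun_on; apply: eq_card => z; rewrite inE.
by apply/forallP/ffun_onP.
Qed.

(** Choose [t] random vertices [z] of [S] and let [U] be the vertices of [S] joined by [G] to all of
    them. On average [U] is large, whereas a [K]-tuple with at most [M] common neighbours falls into
    [U] for at most [M ^ t] choices of [z]. *)
Lemma dependent_random_choice (V : finType) (S : {set V}) (G : rel V) N d K t A M :
  (forall u v, G u v -> (u \in S) && (v \in S)) -> #|S| <= N ->
  N ^ 2 <= d * #|[set p : V * V | G p.1 p.2]| ->
  (2 * d) ^ t.+1 * (N ^ t * A + N ^ K.+1 * M ^ t) < N ^ t.+1 ->
  exists U : {set V}, [/\ U \subset S, A < #|U| &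
    forall x : {ffun 'I_K -> V}, (forall i, x i \in U) ->
      M < #|[set v | [forall i, G (x i) v]]|].
Proof.
move=> GS SN hG hN.
have N0 : 0 < N by case: posnP hN => // ->; rewrite [X in _ < X]exp0n.
pose deg u := #|[set v | G u v]|.
have degN u : deg u <= N.
  apply: leq_trans SN; apply/subset_leq_card/subsetP => v; rewrite inE.
  by move/GS/andP => [].
(* At least [N / (2d)] vertices have degree at least [N / (2d)]; they alone bound the sum of
   [deg u ^ t] from below, in place of convexity. *)
pose H := [set u in S | N <= 2 * d * deg u].
have hH : N <= 2 * d * #|H|.
  have e : #|[set p : V * V | G p.1 p.2]| = \sum_(u in S) deg u.
    rewrite card_pairs [LHS](bigID (mem S)) /= [X in _ + X]big1 ?addn0 // => u uS.
    apply: eq_card0 => v; rewrite inE; apply: contraNF uS => /GS/andP[] //.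
  have := @sum_le_heavy _ S (fun u => 2 * d * deg u) (2 * d * N) N.
  rewrite -big_distrr /= -e => /(_ (fun u _ => leq_mul (leqnn _) (degN u))).
  rewrite -/H => h; rewrite -(leq_pmul2r N0).
  move: hG; rewrite expnS expn1; have := leq_mul SN (leqnn N); nia.
pose Uz (z : {ffun 'I_t -> V}) := [set u in S | [forall i, G u (z i)]].
pose Z := [set z : {ffun 'I_t -> V} | [forall i, z i \in S]].
pose CN (x : {ffun 'I_K -> V}) := [set v | [forall i, G (x i) v]].
pose bad z (x : {ffun 'I_K -> V}) := [forall i, x i \in Uz z] && (#|CN x| <= M).
have cZ : #|Z| <= N ^ t by rewrite card_ffun_forall; exact: leq_exp2rW.
have sumU : N ^ t.+1 <= (2 * d) ^ t.+1 * \sum_(z in Z) #|Uz z|.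
  have -> : \sum_(z in Z) #|Uz z| = \sum_(u in S) deg u ^ t.
    transitivity (\sum_(z in Z) \sum_(u in S | [forall i, G u (z i)]) 1).
      by apply: eq_bigr => z _; rewrite -sum1_card; apply: eq_bigl => u; rewrite inE.
    rewrite (exchange_big_dep (mem S)) => [|z u _ /andP[]//] /=.
    apply: eq_bigr => u uS; rewrite /deg cardsE -card_ffun_forall -sum1_card.
    apply: eq_bigl => z; rewrite !inE uS /=; apply: andb_idl => /forallP h.
    by apply/forallP => i; have /GS/andP[] := h i.
  apply: leq_trans (_ : \sum_(u in H) 2 * d * N ^ t <= _).
    by rewrite sum_nat_const expnS mulnA leq_mul2r [#|_| * _]mulnC hH orbT.
  rewrite big_distrr /= [leqRHS](bigID (mem H)) /=; apply: leq_trans (leq_addr _ _).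
  rewrite (eq_bigl (fun u => (u \in S) && (u \in H))); last first.
    by move=> u; rewrite inE andbA andbb.
  apply: leq_sum => u /andP[_]; rewrite inE => /andP[_ hu].
  rewrite expnS -[leqRHS]mulnA -expnMn leq_mul2l;  by rewrite leq_exp2rW // orbT.
have sumbad : \sum_(z in Z) #|[set x | bad z x]| <= N ^ K * M ^ t.
  apply: leq_trans (_ : \sum_(x in [set x : {ffun 'I_K -> V} | [forall i, x i \in S]])
    M ^ t <= _); last first.
    by rewrite sum_nat_const card_ffun_forall leq_mul2r leq_exp2rW ?orbT.
  under eq_bigr do rewrite -sum1dep_card.
  rewrite (exchange_big_dep (fun x : {ffun 'I_K -> V} =>
    [forall i, x i \in S] && (#|CN x| <= M))) /=; last first.
    move=> z x _ /andP[/forallP xU ->]; rewrite andbT; apply/forallP => i.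
    by have := xU i; rewrite inE => /andP[].
  rewrite [leqRHS](bigID (fun x => #|CN x| <= M)) /=; apply: leq_trans (leq_addr _ _).
  rewrite [leqRHS](eq_bigl (fun x : {ffun 'I_K -> V} =>
    [forall i, x i \in S] && (#|CN x| <= M))); last by move=> x; rewrite inE.
  apply: leq_sum => x /andP[_ xM]; apply: leq_trans (leq_exp2rW _ xM).
  rewrite -card_ffun_forall sum1dep_card; apply/subset_leq_card/subsetP => z.
  rewrite !inE => /andP[_ /andP[/forallP xU _]]; apply/forallP => j.
  suff : z j \in CN x by []. rewrite inE; apply/forallP => i.
  by have := xU i; rewrite inE => /andP[_ /forallP].
(* Each bad tuple is charged [N], which is at least [#|Uz z|], so this surplus excludes every bad
   tuple. *)
have [z zZ hz] : exists2 z, z \in Z & A + N * #|[set x | bad z x]| < #|Uz z|.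
  apply/exists_inP; apply: contraLR hN; rewrite negb_exists_in => /forall_inP h.
  rewrite -leqNgt; apply: leq_trans sumU _; rewrite leq_mul2l; apply/orP; right.
  apply: leq_trans (_ : \sum_(z in Z) (A + N * #|[set x | bad z x]|) <= _).
    by apply: leq_sum => z /h; rewrite -leqNgt.
  rewrite big_split /= sum_nat_const -big_distrr /= leq_add ?leq_mul2r ?cZ ?orbT //.
  by rewrite expnS -mulnA leq_mul2l sumbad orbT.
exists (Uz z); split.
- by apply/subsetP => u; rewrite inE => /andP[].
- exact: leq_ltn_trans (leq_addr _ _) hz.
move=> x xU; rewrite ltnNge; apply/negP => xM.
have UN : #|Uz z| <= N.
  by apply: leq_trans SN; apply/subset_leq_card/subsetP => u; rewrite inE => /andP[].
have : 0 < #|[set x | bad z x]|.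
  by apply/card_gt0P; exists x; rewrite inE /bad xM andbT; apply/forallP.
move: hz UN; set b := #|[set _ | _]|; nia.
Qed.

Lemma transitive_biclique n (T : rel 'I_n) (S : {set 'I_n}) (G : rel 'I_n) N d K :
  tournament T -> 1 < K -> 0 < d ->
  (forall u v, G u v -> (u \in S) && (v \in S)) -> #|S| <= N ->
  N ^ 2 <= d * #|[set p : 'I_n * 'I_n | G p.1 p.2]| ->
  (2 * d) ^ (10 * K) <= N ->
  exists A B : seq 'I_n, [/\ size A = K, size B = K, pairwise T A, pairwise T B & allrel G A B].
Proof.
move=> Ttour K1 d0 GS SN hG hN.
have D2 : 1 < 2 * d by lia.
have twoD e : 2 ^ e <= (2 * d) ^ e by apply: leq_exp2rW.
have N0 : 0 < N by apply: leq_trans hN; rewrite expn_gt0 muln_gt0 d0.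
(* Here [t = 2K] and [A = M = 2 ^ K]. Each of the two terms is at most half of the right side, as
   [(2d) ^ (3K + 2) < N] and [(2d) ^ (2K^2 + 2K + 2) <= N ^ K]. *)
have hdrc : (2 * d) ^ (2 * K).+1 * (N ^ (2 * K) * 2 ^ K + N ^ K.+1 * (2 ^ K) ^ (2 * K))
    < N ^ (2 * K).+1.
  have h1 : 2 * ((2 * d) ^ (2 * K).+1 * 2 ^ K) < N.
    apply: leq_trans hN.
    apply: (@leq_ltn_trans ((2 * d) ^ (1 + ((2 * K).+1 + K)))).
      by rewrite expnD expn1 leq_mul // expnD leq_mul2l twoD orbT.
    by rewrite ltn_exp2l //; lia.
  have h2 : 2 * ((2 * d) ^ (2 * K).+1 * (2 ^ K) ^ (2 * K)) <= N ^ K.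
    apply: leq_trans (leq_exp2rW K hN); rewrite -!expnM.
    apply: (@leq_trans ((2 * d) ^ (1 + ((2 * K).+1 + K * (2 * K))))).
      by rewrite expnD expn1 leq_mul // expnD leq_mul2l twoD orbT.
    by rewrite leq_exp2l //; nia.
  have P1 : 0 < N ^ (2 * K) by rewrite expn_gt0 N0.
  have eP : N ^ (2 * K) = N ^ K * N ^ K by rewrite -expnD; congr (_ ^ _); lia.
  have h1' := ltn_mul2r (N ^ (2 * K)) (2 * ((2 * d) ^ (2 * K).+1 * 2 ^ K)) N.
  rewrite P1 h1 in h1'.
  have h2' := leq_mul2r (N * N ^ K) (2 * ((2 * d) ^ (2 * K).+1 * (2 ^ K) ^ (2 * K))) (N ^ K).
  rewrite h2 orbT in h2'.
  rewrite [in X in _ < X]expnS [N ^ K.+1]expnS.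
  move: h1' h2'; rewrite eP;
  move: (2 ^ K) ((2 ^ K) ^ _) ((2 * d) ^ _) (N ^ K) => e c b a.
  rewrite -![_ = true]/(is_true _) => h1' h2'; nia.
have [U [US UA UB]] := dependent_random_choice GS SN hG hdrc.
have [A [sA AU TA]] := transitive_seq Ttour (ltnW UA).
have x0 : 'I_n by case: A sA {AU TA} => //= K0; move: K1; rewrite -K0.
have /UB/ltnW hB i : [ffun i : 'I_K => nth x0 A i] i \in U.
  by rewrite ffunE; apply: AU; apply: mem_nth; rewrite sA.
have [B [sB BV TB]] := transitive_seq Ttour hB.
exists A, B; split => //; apply/allrelP => u v uA /BV; rewrite inE => /forallP h.
have hi : index u A < K by rewrite -sA index_mem.
by have := h (Ordinal hi); rewrite ffunE /= nth_index.
Qed.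

(** * From many heavy edges to [Dk] *)

Lemma contains_Dk_of_heavy_edges n (T : rel 'I_n) (S : {set 'I_n}) (G : rel 'I_n) N d g k :
  tournament T -> 0 < k -> 0 < g -> 0 < d -> #|S| <= N ->
  (forall u v, G u v -> [/\ u \in S, v \in S, T u v &
     N <= g * #|[set w in S | T v w && T w u]|]) ->
  N ^ 2 <= d * #|[set p : 'I_n * 'I_n | G p.1 p.2]| ->
  (2 * d) ^ (10 * (2 * g * k)) <= N ->
  contains_Dk k T.
Proof.
move=> Ttour k0 g0 d0 SN hG hGd; set K := 2 * g * k => hN.
have K1 : 1 < K by rewrite /K; nia.
have GS u v : G u v -> (u \in S) && (v \in S) by move/hG => [-> ->].
have [A [B [sA sB TA TB GAB]]] := transitive_biclique Ttour K1 d0 GS SN hGd hN.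
pose a w := count (T w) A; pose b w := count (T^~ w) B.
have aK w : a w <= K by rewrite -sA count_size.
have bK w : b w <= K by rewrite -sB count_size.
(* Counting triangles on the pairs of [A] and [B] gives [a w * b w] an average of at least
   [K ^ 2 / g = 2 * k * K]. The threshold is half of it; as both factors are at most [K], passing it
   forces both to be at least [k]. *)
pose H := [set w in S | g * (k * K) <= g * (a w * b w)].
have N0 : 0 < N by apply: leq_trans hN; rewrite expn_gt0 muln_gt0 d0.
have sumab : K * K * N <= \sum_(w in S) g * (a w * b w).
  have -> : \sum_(w in S) g * (a w * b w) =
      \sum_(u <- A) \sum_(v <- B) g * #|[set w in S | T v w && T w u]|.
    under [RHS]eq_bigr do rewrite -big_distrr /=.
    rewrite -!big_distrr /=; congr (_ * _).
    transitivity (\sum_(w in S) \sum_(u <- A) \sum_(v <- B) (T v w && T w u : nat)).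
      apply: eq_bigr => w _; rewrite /a /b -!sum1_count !big_mkcond /= big_distrlr /=.
      apply: eq_bigr => u _. rewrite big_mkcond; apply: eq_bigr => v _.
      by case: (T w u); case: (T v w).
    rewrite exchange_big /=; apply: eq_bigr => u _; rewrite exchange_big /=.
    apply: eq_bigr => v _; rewrite -sum1dep_card big_mkcondr /=.
    by apply: eq_bigr => w _; case: (T v w); case: (T w u).
  apply: leq_trans (_ : \sum_(u <- A) \sum_(v <- B) N <= _).
    by rewrite !big_const_seq !count_predT sA sB !iter_addn_0; lia.
  rewrite big_seq [leqRHS]big_seq; apply: leq_sum => u uA.
  rewrite big_seq [leqRHS]big_seq; apply: leq_sum => v vB.
  by have /hG[] := allrelP GAB _ _ uA vB.
have hH : N <= 2 * g * #|H|.
  have := @sum_le_heavy _ S (fun w => g * (a w * b w)) (g * (K * K)) (g * (k * K)).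
  have hab w : w \in S -> g * (a w * b w) <= g * (K * K).
    by move=> _; rewrite leq_mul2l leq_mul ?aK ?bK ?orbT.
  move=> /(_ hab)/(leq_trans sumab); rewrite -/H => h.
  have := leq_mul SN (leqnn (g * (k * K))).
  suff : K * K * N <= K * K * (2 * g * #|H|) by rewrite leq_pmul2l // muln_gt0; lia.
  have e : 2 * (g * (k * K)) = K * K by rewrite {2}/K; lia.
  nia.
have twoD e : 2 ^ e <= (2 * d) ^ e by apply: leq_exp2rW; lia.
have hHk : #|((K.-tuple bool * K.-tuple bool)%type : finType)| * 2 ^ k < #|H|.
  rewrite card_prod !card_tuple card_bool.
  suff : 2 * g * (2 ^ K * 2 ^ K * 2 ^ k) < N by nia.
  apply: leq_trans hN; apply: leq_trans (twoD _).
  have /leq_ltn_trans : 2 * g <= 2 ^ K.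
    by apply: leq_trans (ltnW (ltn_expl K (isT : 1 < 2))); rewrite /K; nia.
  rewrite -!expnD => /(_ _ _) h.
  apply: leq_ltn_trans (_ : 2 ^ (K + (K + K + k)) < _).
    rewrite [leqRHS]expnD leq_mul2r; apply/orP; right.
    by apply: leq_trans (ltnW (ltn_expl K (isT : 1 < 2))); rewrite /K; nia.
  by rewrite ltn_exp2l // /K; nia.
(* Vertices with equal keys have the same neighbours in [A] and [B]. *)
pose key w : K.-tuple bool * K.-tuple bool :=
  (map_tuple (T w) (tcast sA (in_tuple A)), map_tuple (T^~ w) (tcast sB (in_tuple B))).
have [[m1 m2] /ltnW hfib] := pigeonhole key hHk.
have [W [sW WU TW]] := transitive_seq Ttour hfib.
pose A' := mask m1 A; pose B' := mask m2 B.
have fibP w : w \in W -> [/\ A' = filter (T w) A, B' = filter (T^~ w) B & w \in H].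
  move=> /WU; rewrite inE => /andP[wH /eqP[e1 e2]].
  by rewrite /A' /B' -e1 -e2 /= !val_tcast /= !filter_mask.
have [w0 w0W] : exists w, w \in W.
  by case: (W) sW => [k00|w s _]; [move: k0; rewrite -k00|exists w; rewrite mem_head].
have [sA' sB'] : k <= size A' /\ k <= size B'.
  have [-> ->] := fibP _ w0W; rewrite inE leq_pmul2l // => /andP[_ h].
  rewrite !size_filter -/(a w0) -/(b w0).
  by have := aK w0; have := bK w0; move: h; nia.
(* Edges run from [B'] to [W], from [W] to [A'], and from [A'] to [B'] by the biclique; this fixes
   the cyclic order of the classes. *)
apply: (@contains_Dk_blocks _ T k (take k B') W (take k A')) => //.
- by rewrite size_takel.
- by rewrite size_takel.
- by apply: subseq_pairwise TB; apply: subseq_trans (take_subseq _ _) (mask_subseq _ _).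
- by apply: subseq_pairwise TA; apply: subseq_trans (take_subseq _ _) (mask_subseq _ _).
- apply/allrelP => v w /mem_take + wW; have [_ -> _] := fibP _ wW.
  by rewrite mem_filter => /andP[].
- apply/allrelP => w u wW /mem_take; have [-> _ _] := fibP _ wW.
  by rewrite mem_filter => /andP[].
- apply/allrelP => u v /mem_take/mem_mask uA /mem_take/mem_mask vB.
  by have /hG[] := allrelP GAB _ _ uA vB.
Qed.

(** * Median orders *)

(* Moving the vertices of lower class [c] before those of higher class, without changing
   the order inside a class, does not decrease the number of backwards edges. *)
Definition median n (T : rel 'I_n) : Prop := forall c : 'I_n -> nat,
  #|[set p : 'I_n * 'I_n | [&& T p.1 p.2, p.2 < p.1 & c p.1 < c p.2]]| <=
  #|[set p : 'I_n * 'I_n | [&& T p.1 p.2, p.1 < p.2 & c p.2 < c p.1]]|.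

Lemma perm_of_key n (key : 'I_n -> nat) : injective key ->
  exists s : {perm 'I_n}, forall x y, (s x < s y) = (key x < key y).
Proof.
move=> kinj; pose A x := [set y | key y < key x].
have rk x : #|A x| < n.
  rewrite -[X in _ < X]card_ord -cardsT; apply: proper_card; apply/properP.
  by split; [exact: subsetT|exists x; rewrite ?inE ?ltnn].
have rklt x y : key x < key y -> #|A x| < #|A y|.
  move=> xy; apply: proper_card; apply/properP; split.
    by apply/subsetP => z; rewrite !inE => /ltn_trans; apply.
  by exists x; rewrite inE ?ltnn.
have rkE x y : (#|A x| < #|A y|) = (key x < key y).
  have [/rklt//|/rklt h|/kinj->] := ltngtP (key x) (key y); last by rewrite ltnn.
  by apply/negbTE; rewrite -leqNgt ltnW.
have rinj : injective (fun x => Ordinal (rk x)).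
  move=> x y [exy]; apply: kinj; apply/eqP.
  by have := rkE x y; have := rkE y x; rewrite exy ltnn; lia.
by exists (perm rinj) => x y; rewrite !permE /= rkE.
Qed.

(** The key [c x * n + x] sorts by class, then by position. Compared with the identity, this order
    removes the first set of edges in [median] from the backwards ones and adds the second. *)
Lemma median_of_optimal n (T : rel 'I_n) :
  (forall s, backwards T 1 <= backwards T s) -> median T.
Proof.
move=> opt c.
have kinj : injective (fun x : 'I_n => c x * n + x).
  move=> x y exy; apply/val_inj => /=.
  have := congr1 (modn^~ n) exy; rewrite /= !modnMDl !modn_small //.
have [s hs] := perm_of_key kinj.
have {}hs x y : (s x < s y) = (c x < c y) || (c x == c y) && (x < y).
  by rewrite hs; have := ltn_ord x; have := ltn_ord y; nia.
have := opt s; rewrite /backwards.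
under eq_finset do rewrite !perm1.
under [X in _ <= #|pred_of_set X|]eq_finset do rewrite hs.
set B1 := [set _ | _]; set B2 := [set _ | _]; set S1 := [set _ | _]; set S2 := [set _ | _].
have e1 : B1 :\: B2 = S1.
  by apply/setP => -[x y]; rewrite !inE /=; case: (T x y) => //=; lia.
have e2 : B2 :\: B1 = S2.
  apply/setP => -[x y]; rewrite !inE /=; have [->|] := eqVneq x y; rewrite -?val_eqE /=.
    by case: (T y y) => //=; lia.
  by case: (T x y) => //=; lia.
have := cardsID B2 B1; have := cardsID B1 B2; rewrite e1 e2 setIC; lia.
Qed.

(** Reversing both the order and all edges keeps backwards edges backwards and exchanges in- and
    out-neighbours, so only one of the two cases has to be treated directly. *)
Definition reversal n (T : rel 'I_n) : rel 'I_n := fun x y => T (rev_ord y) (rev_ord x).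

Lemma tournament_reversal n (T : rel 'I_n) : tournament T -> tournament (reversal T).
Proof.
by case=> Ti Ta; split=> [u|u v uv]; rewrite /reversal ?Ti // Ta // (inj_eq rev_ord_inj) eq_sym.
Qed.

Lemma median_reversal n (T : rel 'I_n) : median T -> median (reversal T).
Proof.
move=> med c; pose M := \max_x c x; have cM x : c x <= M by exact: leq_bigmax.
have := med (fun x => M - c (rev_ord x)).
pose r (p : 'I_n * 'I_n) := (rev_ord p.2, rev_ord p.1).
have rK : involutive r by case=> x y; rewrite /r /= !rev_ordK.
have e (P Q : pred ('I_n * 'I_n)) : (forall p, P p = Q (r p)) ->
    #|[set p | P p]| = #|[set p | Q p]|.
  move=> PQ; rewrite -(card_preimset _ (inv_inj rK)); apply: eq_card => p.
  by rewrite !inE PQ rK.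
rewrite (e _ (fun p => [&& reversal T p.1 p.2, p.2 < p.1 & c p.1 < c p.2])); last first.
  case=> x y; rewrite /reversal /= !rev_ordK; congr [&& _, _ & _].
    by have := ltn_ord x; have := ltn_ord y; lia.
  by have := cM (rev_ord x); have := cM (rev_ord y); lia.
rewrite [X in _ <= X -> _](e _ (fun p => [&& reversal T p.1 p.2, p.1 < p.2 & c p.2 < c p.1])) //.
case=> x y; rewrite /reversal /= !rev_ordK; congr [&& _, _ & _].
  by have := ltn_ord x; have := ltn_ord y; lia.
by have := cM (rev_ord x); have := cM (rev_ord y); lia.
Qed.

(** * Directed triangles in a median order *)

(** The classes move [i] to just after [q]: this repairs the edges [x -> i] from the interval and
    spoils the edges [i -> x]. *)
Lemma median_half n (T : rel 'I_n) (i : 'I_n) q : median T ->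
  #|[set x : 'I_n | (i < x <= q) && T x i]| <= #|[set x : 'I_n | (i < x <= q) && T i x]|.
Proof.
move=> /(_ (fun x => if x < i then 0 else if x == i then 2 else if x <= q then 1 else 3)) h.
have inj1 : injective (fun x : 'I_n => (x, i)) by move=> x y [].
have inj2 : injective (fun x : 'I_n => (i, x)) by move=> x y [].
rewrite -(card_imset _ inj1) -(card_imset [set x | _ && T i x] inj2).
apply: leq_trans (leq_trans h _); apply: subset_leq_card; apply/subsetP => p.
  case/imsetP => x; rewrite inE => /andP[/andP[ix xq] xi] -> /=; rewrite inE /= xi ix xq.
  by rewrite ltnn eqxx -val_eqE /= (gtn_eqF ix) (ltnNge x i) (ltnW ix).
case: p => u v; rewrite inE /= => /and3P[uv ltuv hc].
have [eu vq] : u = i /\ v <= q.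
  split; [apply: val_inj => /=|]; move: hc ltuv; rewrite -!val_eqE /=;
  by do !case: ifP; lia.
by apply/imsetP; exists v; rewrite -eu // inE uv vq ltuv.
Qed.

(** The chain is [#|Q| ^ 2 <= 2 * #|L| <= 2 * #|X| <= 4 * #|Tri|]; the last two inequalities use the
    median property, each with its own classes. *)
Lemma median_fan n (T : rel 'I_n) (i : 'I_n) y : tournament T -> median T ->
  #|[set x : 'I_n | (i < x < y) && T x i]| ^ 2 <=
  4 * #|[set p : 'I_n * 'I_n |
         [&& i < p.1, p.1 < p.2, p.2 < y & [&& T i p.1, T p.1 p.2 & T p.2 i]]]|.
Proof.
move=> [Ti Ta] med; set Q := [set x | _]; set Tri := [set p | _].
pose X := [set p : 'I_n * 'I_n | [&& i < p.1, p.1 < p.2, p.2 < y, T i p.1 & T p.2 i]].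
have hX : #|X| <= 2 * #|Tri|.
  (* These classes move [Q] before [i] and its out-neighbours. For a pair of [X], an edge [q -> p]
     is repaired; every spoiled edge is some [p -> q] of [Tri]. *)
  pose c (x : 'I_n) := if x < i then 0 else if x < y then (if T x i then 1 else 2) else 3.
  have cQ (x : 'I_n) : i <= x -> x < y -> T x i -> c x = 1 by rewrite /c (ltnNge x i) => -> -> ->.
  have cP (x : 'I_n) : i <= x -> x < y -> T x i = false -> c x = 2.
    by rewrite /c (ltnNge x i) => -> -> ->.
  have h := med c; rewrite (card_pairsC (fun u v => [&& T u v, v < u & c u < c v])) in h.
  rewrite mul2n -addnn.
  apply: leq_trans (leq_trans (leq_card_setU _ _) (leq_add (leqnn _) (leq_trans h _))).
    apply/subset_leq_card/subsetP => -[p q]; rewrite !inE /=.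
    move=> /and5P[ip pq qy Tip Tqi]; rewrite ip pq qy Tip Tqi /= andbT.
    have piF : T p i = false.
      by apply/negbTE; rewrite -Ta // -val_eqE /= (ltn_eqF ip).
    rewrite (cQ q) ?(cP p) ?(ltnW ip) ?(ltnW (ltn_trans ip pq)) ?(ltn_trans pq qy) //.
    by rewrite andbT [T p q]Ta ?orNb // -val_eqE /= (ltn_eqF pq).
  apply/subset_leq_card/subsetP => -[p q]; rewrite !inE /= => /and3P[Tpq pq].
  have [lpi|] := ltnP p i; first by rewrite {2}/c lpi.
  have [qy|yq ip] := ltnP q y; last first.
    have -> : c q = 3 by rewrite /c (ltnNge q i) (ltnNge q y) (leq_trans ip (ltnW pq)) yq.
    by rewrite /c; do !case: ifP.
  rewrite leq_eqVlt => /orP[/eqP/val_inj ip|ip].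
    subst p; rewrite [c i]cP ?(ltn_trans pq qy) ?(negbTE (Ti _)) // => hc.
    have Tqi : T q i by move: hc; rewrite /c (ltnNge q i) (ltnW pq) qy; case: (T q i).
    by move: Tpq; rewrite Ta ?Tqi // -val_eqE /= (ltn_eqF pq).
  rewrite {2}/c /c (ltnNge q) (ltnNge p) (ltnW (ltn_trans ip pq)) (ltnW ip) /=.
  rewrite qy (ltn_trans pq qy) ip pq Tpq /= andbC.
  case: (T q i); last by case: (T p i).
  have [//|Tpi _] := boolP (T p i); rewrite Ta // -val_eqE /=.
  by rewrite (ltn_eqF ip).
(* [L] includes the diagonal, hence at least half of all pairs of [Q]. It is compared with [X] for
   each [q] separately, by [median_half] on the interval ending at [q]. *)
pose L := [set p : 'I_n * 'I_n | [&& p.1 \in Q, p.2 \in Q & p.1 <= p.2]].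
have hL : #|L| <= #|X|.
  rewrite /L /X (card_pairsC (fun p q => [&& p \in Q, q \in Q & p <= q])).
  rewrite (card_pairsC (fun p q : 'I_n => [&& i < p, p < q, q < y, T i p & T q i])).
  rewrite (card_pairs (fun q p => [&& p \in Q, q \in Q & p <= q])).
  rewrite (card_pairs (fun q p : 'I_n => [&& i < p, p < q, q < y, T i p & T q i])).
  apply: leq_sum => q _.
  have [qQ|qQ] := boolP (q \in Q); last first.
    by rewrite eq_card0 // => p; apply: contraNF qQ; rewrite inE => /and3P[].
  move: (qQ); rewrite inE => /andP[/andP[iq qy] Tqi].
  apply: leq_trans (leq_trans (median_half i q med) _); apply/subset_leq_card/subsetP => p.
    by rewrite !inE => /and3P[/andP[/andP[-> _] ->] _ ->].
  rewrite !inE => /andP[/andP[-> pq] Tip]; rewrite qy Tip Tqi !andbT ltn_neqAle pq andbT /=.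
  apply/eqP => /val_inj epq; subst p; move: Tip; rewrite Ta ?Tqi // -val_eqE /=.
  by rewrite (ltn_eqF iq).
have hQ : #|Q| ^ 2 <= 2 * #|L|.
  rewrite expnS expn1 -cardsX mul2n -addnn.
  have {2}-> : #|L| = #|[set p : 'I_n * 'I_n | [&& p.2 \in Q, p.1 \in Q & p.2 <= p.1]]|.
    exact: card_pairsC (fun p q => [&& p \in Q, q \in Q & p <= q]).
  apply: leq_trans (leq_card_setU _ _); apply/subset_leq_card/subsetP => -[p q].
  by rewrite !inE /= => /andP[/andP[-> ->] /andP[-> ->]]; rewrite leq_total.
by lia.
Qed.

(** * Heavy edges in a window *)

Lemma card_ord_interval n a b : #|[set x : 'I_n | a <= x < b]| = minn b n - a.
Proof.
rewrite cardE -(size_map val) -(size_iota a (minn b n - a)); apply: perm_size.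
apply: uniq_perm; rewrite ?iota_uniq ?(map_inj_uniq val_inj) ?enum_uniq // => x.
rewrite mem_iota; apply/mapP/idP => [[z]|hx].
  by rewrite mem_enum inE => hz -> /=; have := ltn_ord z; lia.
have xn : x < n by lia.
by exists (Ordinal xn); rewrite // mem_enum inE /=; lia.
Qed.

Definition heavy n (T : rel 'I_n) (S : {set 'I_n}) L : rel 'I_n := fun u v =>
  [&& u \in S, v \in S, T u v & L <= 576 * #|[set w in S | T v w && T w u]|].

Lemma heavy_reversal n (T : rel 'I_n) (S : {set 'I_n}) L u v :
  heavy (reversal T) (@rev_ord n @^-1: S) L u v = heavy T S L (rev_ord v) (rev_ord u).
Proof.
rewrite /heavy !inE andbCA; congr [&& _, _, _ & _ <= _ * _].
rewrite -[RHS](card_preimset _ rev_ord_inj); apply: eq_card => w.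
by rewrite !inE /reversal [T _ _ && T _ _ in RHS]andbC.
Qed.

Lemma heavy_in n (T : rel 'I_n) (S : {set 'I_n}) L (i : 'I_n) y :
  tournament T -> median T -> 0 < L -> y <= i + 2 * L ->
  (forall x : 'I_n, i <= x < y -> x \in S) ->
  L <= 6 * #|[set x : 'I_n | (i < x < y) && T x i]| ->
  L <= 576 * #|[set q | heavy T S L q i]|.
Proof.
move=> Ttour med L0 yL hS; set Q := [set x | _ && T x i] => hQ.
pose R := [set x : 'I_n | i < x < y].
have RL : #|R| <= 2 * L.
  rewrite (_ : R = [set x : 'I_n | i.+1 <= x < y]); last by apply/setP => x; rewrite !inE.
  by rewrite card_ord_interval; lia.
have /card_gt0P[x0] : 0 < #|Q|.
  by rewrite lt0n; apply: contraTneq hQ => ->; rewrite muln0 -ltnNge.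
rewrite inE => /andP[/andP[ix0 x0y] _].
have iS : i \in S by apply: hS; rewrite leqnn (ltn_trans ix0 x0y).
have := median_fan i y Ttour med; rewrite -/Q.
pose F (q : 'I_n) := #|[set p : 'I_n | [&& i < p, p < q, T i p, T p q & T q i]]|.
rewrite (card_pairsC (fun p q : 'I_n =>
  [&& i < p, p < q, q < y & [&& T i p, T p q & T q i]])).
rewrite (card_pairs (fun q p : 'I_n =>
  [&& i < p, p < q, q < y & [&& T i p, T p q & T q i]])) => hfan.
have {}hfan : #|Q| ^ 2 <= 4 * \sum_(q in R) F q.
  apply: leq_trans hfan _; rewrite leq_mul2l /= [leqRHS]big_mkcond /=.
  apply: leq_sum => q _; rewrite inE; case: ifP => [/andP[iq qy]|hq].
    by apply/subset_leq_card/subsetP => p; rewrite !inE qy.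
  rewrite leqn0 cards_eq0; apply/eqP/setP => p; rewrite !inE.
  by apply/negbTE; move: hq; lia.
have FR q : q \in R -> 576 * F q <= 576 * (2 * L).
  rewrite inE => /andP[_ qy]; rewrite leq_mul2l; apply: leq_trans RL.
  apply/subset_leq_card/subsetP => p; rewrite !inE => /and3P[-> pq _].
  exact: ltn_trans qy.
have := @sum_le_heavy _ R (fun q => 576 * F q) (576 * (2 * L)) L FR.
set Hq := [set q in R | _]; rewrite -big_distrr /= => hsum.
have hHq : #|Hq| <= #|[set q | heavy T S L q i]|.
  apply/subset_leq_card/subsetP => q; rewrite !inE => /andP[/andP[iq qy] hq].
  have /card_gt0P[p] : 0 < F q.
    by rewrite lt0n; apply: contraTneq hq => ->; rewrite muln0 -ltnNge.
  rewrite inE => /and5P[_ _ _ _ Tqi]. 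
  rewrite /heavy iS Tqi hS ?(ltnW iq) ?qy //=; apply: leq_trans hq _; rewrite leq_mul2l.
  apply/subset_leq_card/subsetP => w; rewrite !inE => /and5P[iw wq -> -> _].
  by rewrite hS // (ltnW iw) (ltn_trans wq).
(* Since [#|Q| >= L / 6], the sum of [576 * F q] is at least [4 * L ^ 2]. Light [q] account for at
   most [#|R| * L <= 2 * L ^ 2], and each heavy one for at most [1152 * L], so at least [L / 576]
   are heavy. *)
move: hsum hfan (leq_mul RL (leqnn L)) (leq_mul hQ hQ).
move: (\sum_(q in R) F q) hHq => s hHq; rewrite expnS expn1 => h1 h2 h3 h4.
have h5 : L * L <= 576 * #|[set q | heavy T S L q i]| * L.
  move: h1 h2 h3 h4 (leq_mul hHq (leqnn L)).
  move: #|Hq| #|R| #|Q| #|[set _ | _]| => h r q H; nia.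
by rewrite leq_pmul2r in h5.
Qed.

Lemma heavy_out n (T : rel 'I_n) (S : {set 'I_n}) L (i y : 'I_n) :
  tournament T -> median T -> 0 < L -> y <= i + 2 * L ->
  (forall x : 'I_n, i < x <= y -> x \in S) ->
  L <= 6 * #|[set x : 'I_n | (i < x < y) && T y x]| ->
  L <= 576 * #|[set q | heavy T S L y q]|.
Proof.
move=> Ttour med L0 yL hS hQ.
have <- : #|[set q | heavy (reversal T) (@rev_ord n @^-1: S) L q (rev_ord y)]| =
    #|[set q | heavy T S L y q]|.
  rewrite -[RHS](card_preimset _ rev_ord_inj); apply: eq_card => q.
  by rewrite !inE heavy_reversal rev_ordK.
apply: (heavy_in (y := rev_ord i) (tournament_reversal Ttour) (median_reversal med) L0).
- by rewrite /=; have := ltn_ord y; have := ltn_ord i; lia.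
- move=> x hx; rewrite inE; apply: hS; move: hx => /=.
  by have := ltn_ord y; have := ltn_ord i; have := ltn_ord x; lia.
apply: leq_trans hQ _; rewrite leq_mul2l /= -(card_preimset _ rev_ord_inj).
apply/subset_leq_card/subsetP => x; rewrite !inE /reversal !rev_ordK => /andP[hx ->].
by move: hx => /=; have := ltn_ord y; have := ltn_ord i; have := ltn_ord x; lia.
Qed.

(** An edge [y -> i] of the left side is heavy, or [i] has many heavy in-edges, or [y] many heavy
    out-edges. Each vertex of [RI] or [RO] accounts for [L / 576] heavy edges, which bounds the last
    two cases. *)
Lemma many_heavy_edges n (T : rel 'I_n) L j :
  tournament T -> median T -> 1 < L ->
  #|[set p : 'I_n * 'I_n | [&& T p.1 p.2, p.2 + L <= p.1 < p.2 + 2 * L &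
       p.2 %/ L == j]]| <=
  3457 * #|[set p : 'I_n * 'I_n |
    heavy T [set x : 'I_n | j * L <= x < (j + 3) * L] L p.1 p.2]|.
Proof.
move=> Ttour med L1; set S := [set x : 'I_n | _]; set F := [set p | _]; set H := [set p | _].
have [Ti Ta] := Ttour.
have SL : #|S| <= 3 * L by rewrite card_ord_interval; lia.
pose RI := [set i | L <= 576 * #|[set q | heavy T S L q i]|].
pose RO := [set y | L <= 576 * #|[set q | heavy T S L y q]|].
have hRO : L * #|RO| <= 576 * #|H|.
  rewrite (card_pairs (heavy T S L)) big_distrr /= mulnC -sum_nat_const.
  rewrite [leqRHS](bigID (mem RO)) /=; apply: leq_trans (leq_addr _ _).
  by apply: leq_sum => y; rewrite inE.
have hRI : L * #|RI| <= 576 * #|H|.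
  rewrite /H (card_pairsC (heavy T S L)) (card_pairs (fun q p => heavy T S L p q)).
  rewrite big_distrr /= mulnC -sum_nat_const.
  rewrite [leqRHS](bigID (mem RI)) /=; apply: leq_trans (leq_addr _ _).
  by apply: leq_sum => y; rewrite inE.
(* 3457 = 1 + 2 * 3 * 576: the ends of each edge of [F] lie in [S], of size at most [3 * L]. *)
suff : #|F| <= #|H| + #|setX S RI| + #|setX RO S|.
  by rewrite !cardsX; nia.
apply: leq_trans (leq_trans (leq_card_setU _ _) (leq_add (leq_card_setU _ _) (leqnn _))).
apply/subset_leq_card/subsetP => -[y i]; rewrite !inE /=.
move=> /and3P[Tyi /andP[hy1 hy2] /eqP hj].
have hi : j * L <= i < (j + 1) * L.
  by rewrite -hj leq_divM /= addn1 ltn_ceil // ltnW.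
have inS x : i <= x <= y -> j * L <= x < (j + 3) * L by lia.
rewrite !inS ?leqnn ?andbT /=; try lia.
pose W := [set x : 'I_n | i.+1 <= x < y].
pose A := [set x : 'I_n | (i < x < y) && (T i x && T x y)].
pose B := [set x : 'I_n | (i < x < y) && T x i].
pose C := [set x : 'I_n | (i < x < y) && T y x].
have WABC : #|W| <= #|A| + #|B| + #|C|.
  apply: leq_trans (leq_trans (leq_card_setU _ _) (leq_add (leq_card_setU _ _) (leqnn _))).
  apply/subset_leq_card/subsetP => x; rewrite !inE => /andP[ix xy]; rewrite ix xy /=.
  rewrite [T i x]Ta; last by rewrite -val_eqE /= ltn_eqF.
  rewrite [T x y]Ta; last by rewrite -val_eqE /= ltn_eqF.
  by case: (T x i); case: (T y x).
have cW : #|W| = y - i.+1 by rewrite card_ord_interval; have := ltn_ord y; lia.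
have [hA|hA] := leqP L (6 * #|A|).
  rewrite -orbA; apply/orP; left; rewrite /heavy !inE !inS ?leqnn ?Tyi /=; try lia.
  apply: leq_trans hA _; apply: leq_mul => //.
  by apply/subset_leq_card/subsetP => x; rewrite !inE => /andP[hx ->]; rewrite inS //; lia.
have [hB|hB] := leqP L (6 * #|B|).
  apply/orP; left; apply/orP; right; apply: (heavy_in Ttour med _ _ _ hB) => //.
  - exact: ltnW.
  - exact: ltnW.
  - by move=> x hx; rewrite inE inS //; lia.
apply/orP; right; apply: (heavy_out (i := i) Ttour med) => //.
- exact: ltnW.
- exact: ltnW.
- by move=> x hx; rewrite inE inS //; lia.
(* [#|A| + #|B| + #|C| >= L - 1], while [6 * #|A|] and [6 * #|B|] are at most [L - 1]; so
   [6 * #|C| >= 4 * (L - 1) >= L], as [L > 1]. *)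
- by rewrite -/C; lia.
Qed.

(** * Locating a scale and a window *)

(** With [L0 = n %/ (8 * d)], at most [n * L0 <= n ^ 2 / (8 * d)] backwards edges are shorter than
    [L0]. The others are split by dyadic length, and the bounds for poor scales form a geometric
    series. *)
Lemma backward_scale n (T : rel 'I_n) d : 0 < d -> 8 * d <= n ->
  n ^ 2 <= d * #|[set p : 'I_n * 'I_n | T p.1 p.2 && (p.2 < p.1)]| ->
  exists L, n %/ (8 * d) <= L /\ n * L <=
    8 * d * #|[set p : 'I_n * 'I_n | T p.1 p.2 && (p.2 + L <= p.1 < p.2 + 2 * L)]|.
Proof.
move=> d0 dn hb; set L0 := n %/ (8 * d).
have L00 : 0 < L0 by rewrite divn_gt0 // muln_gt0 d0.
have L0n : 8 * d * L0 <= n by rewrite mulnC leq_divM.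
pose c L := #|[set p : 'I_n * 'I_n | T p.1 p.2 && (p.2 + L <= p.1 < p.2 + 2 * L)]|.
pose a L := #|[set p : 'I_n * 'I_n | T p.1 p.2 && (p.2 < p.1 < p.2 + L)]|.
case: (classic (exists L, L0 <= L /\ n * L <= 8 * d * c L)) => // hno; exfalso.
(* If every dyadic scale is poor, summing over the scales contradicts [hb]. *)
have hc r : 8 * d * c (2 ^ r * L0) <= n * (2 ^ r * L0).
  have [//|/ltnW h] := leqP; exfalso; apply: hno; exists (2 ^ r * L0).
  by rewrite leq_pmull ?expn_gt0.
have ha r : 8 * d * a (2 ^ r * L0) <= n * n + n * (2 ^ r * L0).
  elim: r => [|r IH].
    have : a (2 ^ 0 * L0) <= n * L0.
      rewrite /a (card_pairsC (fun u v : 'I_n => T u v && (v < u < v + 2 ^ 0 * L0))).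
      rewrite (card_pairs (fun v u : 'I_n => T u v && (v < u < v + 2 ^ 0 * L0))).
      rewrite -[X in _ <= X * _]card_ord -sum_nat_const; apply: leq_sum => v _.
      apply: leq_trans (_ : #|[set u : 'I_n | v <= u < v + L0]| <= _).
        apply/subset_leq_card/subsetP => u; rewrite !inE mul1n => /and3P[_ /ltnW-> ->].
        by [].
      by rewrite card_ord_interval; lia.
    by move: L0n; nia.
  have : a (2 ^ r.+1 * L0) <= a (2 ^ r * L0) + c (2 ^ r * L0).
    apply: leq_trans (leq_card_setU _ _); apply/subset_leq_card/subsetP => -[u v].
    rewrite !inE /= expnS -mulnA => /andP[-> /andP[-> ->]] /=.
    by rewrite andbT; case: leqP.
  move=> /(leq_mul (leqnn (8 * d)))/leq_trans; apply; move: (hc r) IH.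
  by rewrite expnS -[2 * _ * L0]mulnA; lia.
(* At the first scale reaching [n], [ha] bounds [8 * d] times the number of all backwards edges by
   [3 * n ^ 2], against [8 * n ^ 2] from [hb]. *)
have [r hr1 hr2] : exists2 r, n <= 2 ^ r * L0 & 2 ^ r * L0 <= 2 * n.
  have ex : exists r, n <= 2 ^ r * L0.
    by exists n; rewrite (leq_trans (ltnW (ltn_expl n (isT : 1 < 2)))) // leq_pmulr.
  exists (ex_minn ex); case: ex_minnP => // r hr hmin.
  case: r hr hmin => [|r] hr hmin; first by rewrite mul1n; move: L0n; nia.
  rewrite expnS -mulnA leq_mul2l /= ltnW // ltnNge.
  by apply/negP => /hmin; rewrite ltnn.
have hbr : a (2 ^ r * L0) = #|[set p : 'I_n * 'I_n | T p.1 p.2 && (p.2 < p.1)]|.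
  apply: eq_card => -[u v]; rewrite !inE /=; congr andb; rewrite -[RHS]andbT; congr andb.
  by have := ltn_ord u; lia.
have := ha r; rewrite hbr.
have n0 : 0 < n by apply: leq_trans dn; rewrite muln_gt0 d0.
by move: hb hr2; rewrite expnS expn1; move: #|[set _ | _]| (2 ^ r * L0) => b x; nia.
Qed.

(** The lower ends [p.2] lie in at most [2 * n / L] blocks of length [L]; some block receives at
    least the average. *)
Lemma backward_window n (T : rel 'I_n) d L : 0 < d -> 0 < L -> 0 < n ->
  n * L <= 8 * d * #|[set p : 'I_n * 'I_n | T p.1 p.2 && (p.2 + L <= p.1 < p.2 + 2 * L)]| ->
  exists j, L ^ 2 <= 16 * d * #|[set p : 'I_n * 'I_n |
    [&& T p.1 p.2, p.2 + L <= p.1 < p.2 + 2 * L & p.2 %/ L == j]]|.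
Proof.
move=> d0 L0 n0; set A := [set p | _] => hA.
have A0 : 0 < #|A|.
  by rewrite lt0n; apply: contraTneq hA => ->; rewrite muln0 -ltnNge muln_gt0 n0.
have Ln : L <= n.
  by have /card_gt0P[[u v]] := A0; rewrite inE /= => /andP[_]; have := ltn_ord u; lia.
(* The predecessor fits the strict inequality of [pigeonhole]: [m < x] means
   [L ^ 2 <= 16 * d * x]. *)
pose m := (L ^ 2).-1 %/ (16 * d).
have hm : #|'I_(n %/ L).+1| * m < #|A|.
  rewrite card_ord; have := leq_divM (L ^ 2).-1 (16 * d); rewrite -/m.
  have := leq_divM n L; rewrite expnS expn1 => h1 h2.
  have h3 : 16 * d * ((n %/ L).+1 * m) < 16 * d * #|A|.
    have : (n %/ L).+1 * (L * L).-1 < 16 * d * #|A|.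
      have : (n %/ L).+1 * (L * L).-1 < (n %/ L).+1 * (L * L).
        by rewrite ltn_pmul2l // prednK // muln_gt0 L0.
      have : (n %/ L).+1 * L <= 2 * n by rewrite mulSn; lia.
      by move: hA; nia.
    by nia.
  by move: h3; rewrite ltn_pmul2l // muln_gt0 d0.
have [j hj] := pigeonhole (fun p : 'I_n * 'I_n => inord (p.2 %/ L)) hm.
exists (val j); rewrite -[L ^ 2]prednK; last by rewrite expn_gt0 L0.
rewrite mulnC -ltn_divLR ?muln_gt0 ?d0 // -/m; apply: leq_trans hj _.
apply/subset_leq_card/subsetP => -[u v]; rewrite !inE /= => /andP[/andP[-> ->] /eqP <-].
have hv : v %/ L < (n %/ L).+1 by rewrite ltnS leq_div2r // ltnW.
by rewrite -[X in _ == X]/(nat_of_ord (inord (v %/ L))) inordK ?eqxx.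
Qed.

(** * From far tournaments to [Dk], with constants *)

Lemma contains_Dk_of_far_median n (T : rel 'I_n) d k :
  tournament T -> median T -> 0 < k -> 0 < d ->
  n ^ 2 <= d * #|[set p : 'I_n * 'I_n | T p.1 p.2 && (p.2 < p.1)]| ->
  (2 * (144 * 3457 * d)) ^ (10 * (2 * 1728 * k)) * (16 * d) <= n ->
  contains_Dk k T.
Proof.
move=> Ttour med k0 d0 hb; set P := _ ^ _ => hn.
have P0 : 1 < P.
  by rewrite -[1](exp1n (10 * (2 * 1728 * k))) ltn_exp2r; lia.
have n0 : 16 * d < n by apply: leq_trans hn; nia.
have dn : 8 * d <= n by lia.
have [L [hL hscale]] := backward_scale d0 dn hb.
have L1 : 1 < L.
  by apply: leq_trans hL; rewrite leq_divRL; [nia|lia].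
have nL : n < 16 * d * L.
  have d8 : 0 < 8 * d by lia.
  by have := ltn_ceil n d8; nia.
have [j hj] := backward_window d0 (ltnW L1) (leq_ltn_trans (leq0n _) n0) hscale.
have hheavy := leq_trans hj (leq_mul (leqnn _) (many_heavy_edges j Ttour med L1)).
(* The window has length [3 * L]: hence [1728 = 3 * 576], and [144 = 9 * 16] from [(3 * L) ^ 2] and
   the [16 * d] of [backward_window]. *)
apply: (@contains_Dk_of_heavy_edges _ T [set x : 'I_n | j * L <= x < (j + 3) * L]
  (heavy T [set x : 'I_n | j * L <= x < (j + 3) * L] L) (3 * L) (144 * 3457 * d) 1728) => //.
- by rewrite !muln_gt0.
- by rewrite card_ord_interval (leq_trans (leq_sub2r _ (geq_minl _ _))) // -mulnBl addKn.
- move=> u v /and4P[-> -> -> h]; split => //.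
  by rewrite (leq_trans (leq_mul (leqnn 3) h)) // mulnA.
- by rewrite expnMn; move: hheavy; lia.
by rewrite -/P; nia.
Qed.

(** As [d >= 2], constants become powers of [d]: [2 * a <= d ^ (2 * a)] and [16 * d <= d ^ 5]. *)
Lemma absorb_constants a g d k : 1 < d -> 0 < k ->
  (2 * (a * d)) ^ (10 * (2 * g * k)) * (16 * d) <=
    d ^ (((2 * a).+1 * (10 * (2 * g)) + 5) * k).
Proof.
move=> d1 k0.
have h2 m : 2 ^ m <= d ^ m by apply: leq_exp2rW.
rewrite mulnDl expnD; apply: leq_mul.
  have -> : (2 * a).+1 * (10 * (2 * g)) * k = (2 * a).+1 * (10 * (2 * g * k)) by lia.
  rewrite [leqRHS]expnM leq_exp2rW // mulnA expnSr leq_mul2r; apply/orP; right.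
  exact: leq_trans (ltnW (ltn_expl _ (isT : 1 < 2))) (h2 _).
apply: (@leq_trans (d ^ 5)); last by rewrite leq_exp2l //; lia.
by rewrite expnSr leq_mul // (h2 4).
Qed.

Lemma contains_Dk_of_far : exists2 C, 0 < C & forall n (T : rel 'I_n) d k,
  tournament T -> 0 < k -> 1 < d -> (forall s, n ^ 2 <= d * backwards T s) ->
  d ^ (C * k) <= n -> contains_Dk k T.
Proof.
exists ((2 * (144 * 3457)).+1 * (10 * (2 * 1728)) + 5); first exact: ltn_addl.
move=> n T d k [Ti Ta] k0 d1 far hn.
have [s0 _ s0min] := arg_minnP (fun s => backwards T s) (isT : predT (1%g : {perm 'I_n})).
(* Relabelling by an optimal order [s0] makes the identity optimal. *)
pose T' : rel 'I_n := fun x y => T (s0^-1%g x) (s0^-1%g y).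
have bT' s : backwards T' s = backwards T (s0 * s)%g.
  pose r (p : 'I_n * 'I_n) := (s0 p.1, s0 p.2).
  have rinj : injective r by move=> [x y] [x' y'] [/perm_inj-> /perm_inj->].
  rewrite /backwards -(card_preimset _ rinj); apply: eq_card => p.
  by rewrite !inE /T' /= !permK !permM.
have tT' : tournament T'.
  by split=> [u|u v uv]; rewrite /T' ?Ti // Ta // (inj_eq perm_inj).
have mT' : median T'.
  by apply: median_of_optimal => s; rewrite !bT' mulg1; apply: s0min.
have hb : n ^ 2 <= d * #|[set p : 'I_n * 'I_n | T' p.1 p.2 && (p.2 < p.1)]|.
  have := far s0; rewrite -[s0 in backwards _ s0]mulg1 -bT' /backwards.
  by under eq_finset do rewrite !perm1.
have [f [finj fT]] := contains_Dk_of_far_median tT' mT' k0 (ltnW d1) hb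
  (leq_trans (absorb_constants _ _ d1 k0) hn).
by exists (fun i => s0^-1%g (f i)); split => // i j /perm_inj/finj.
Qed.

(** * Passage to real [eps] *)

Lemma INR_expn d m : INR (d ^ m) = (INR d ^ m)%R.
Proof. by elim: m => // m IH; rewrite expnS mult_INR IH. Qed.

(** No edge is backwards both for an order and for its reverse, so one of the two has at most
    [n ^ 2 / 2] backwards edges. *)
Lemma eps_far_le_half n (T : rel 'I_n) eps :
  tournament T -> 0 < n -> eps_far T eps -> (eps <= / 2)%R.
Proof.
move=> [Ti Ta] n0 far.
have h1 := far 1%g; have h2 := far (perm (@rev_ord_inj n)).
have hs : backwards T 1 + backwards T (perm (@rev_ord_inj n)) <= n * n.
  have <- : #|[set: 'I_n * 'I_n]| = n * n by rewrite cardsT card_prod !card_ord.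
  rewrite -cardsUI.
  rewrite [X in _ + #|pred_of_set X|](_ : _ = set0) ?cards0 ?addn0 ?subset_leq_card ?subsetT //.
  apply/setP => -[u v]; rewrite !inE !permE /=.
  by have := ltn_ord u; have := ltn_ord v; case: (T u v) => //=; lia.
have {}hs : (INR (backwards T 1%g) + INR (backwards T (perm (@rev_ord_inj n))) <= INR (n * n))%R.
  by rewrite -plus_INR; apply: le_INR; apply/leP.
have : (0 < INR (n * n))%R by apply: lt_0_INR; apply/ltP; rewrite muln_gt0 n0.
by move: h1 h2 hs; nra.
Qed.

Theorem theorem2 :
  exists C : R, (0 < C)%R /\
    forall (eps : R), (0 < eps)%R ->
    forall (k n : nat) (T : rel 'I_n),
      tournament T ->
      (Rpower eps (- (C * INR k)) <= INR n)%R ->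
      eps_far T eps ->
      contains_Dk k T.
Proof.
have [C C0 hC] := contains_Dk_of_far.
(* The factor 2 pays for rounding [x = / eps] up to the integer [d]: [d <= x + 1 <= x ^ 2], as
   [x >= 2]. *)
exists (2 * INR C)%R; split.
  by have : (0 < INR C)%R by [apply: lt_0_INR; apply/ltP]; lra.
move=> eps eps0 k n T Ttour hn far.
have [->|k0] := posnP k; first exact: (@contains_Dk_blocks _ T 0 [::] [::] [::]).
have n0 : 0 < n.
  rewrite lt0n; apply/eqP => e; move: hn; rewrite {1}e /= => /Rle_not_lt; apply.
  exact: exp_pos.
have eps2 := eps_far_le_half Ttour n0 far.
pose x := (/ eps)%R.
have x2 : (2 <= x)%R.
  by rewrite -[2%R]Rinv_inv; apply: Rinv_le_contravar.
have xe : (x * eps = 1)%R by rewrite /x Rinv_l //; lra.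
have [up1 up2] := archimed x.
have [d dZ] : exists d, up x = Z.of_nat d by apply/IZN/le_IZR; lra.
have dE : INR d = IZR (up x) by rewrite INR_IZR_INZ dZ.
have d1 : 1 < d by apply/ltP; apply: INR_lt; rewrite dE /=; lra.
apply: (hC n T d k Ttour k0 d1).
  move=> s; apply/leP; apply: INR_le; rewrite expnS expn1 (mult_INR d) dE.
  have := far s; have : (0 <= INR (backwards T s))%R by apply: pos_INR.
  move: (INR (backwards T s)) (INR (n * n)) => b m b0 hm.
  have := Rmult_le_compat_l x _ _ (Rlt_le _ _ (Rlt_le_trans _ _ _ Rlt_0_2 x2)) hm.
  have := Rmult_le_compat_r b _ _ b0 (Rlt_le _ _ up1).
  by rewrite -Rmult_assoc xe; lra.
apply/leP; apply: INR_le; rewrite INR_expn.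
apply: Rle_trans hn.
have -> : Rpower eps (- (2 * INR C * INR k)) = ((x ^ 2) ^ (C * k))%R.
  rewrite -pow_mult -Rpower_pow; last lra.
  rewrite /Rpower /x ln_Rinv // !mult_INR; congr exp.
  by rewrite /=; ring.
by apply: pow_incr; rewrite dE; split; nra.
Qed.
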